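(* £ is classic, i.e.: (i) every sentence provable in classical first-order logic (in the language of £) is a thesis of £, and some thesis of £ is not provable in classical logic; and (ii) for no sentence $A$ is it the case both that $\Vdash A$ and that classical logic proves $\neg A$.
   Context: The language of the librationist theory £: variables; primitive set constants $\mathcal T$ (truth set) and $\mathcal F$; atomic formulas $a\in b$; formulas $\downarrow AB$ (joint denial), $\forall vA$; terms $\{v\mid A\}$; name terms $\ulcorner X\urcorner$. $\neg A:=\downarrow AA$, other connectives and $\exists$ classical; $\mathcal TA$ abbreviates $\ulcorner A\urcorner\in\mathcal T$. Semantics: for each $n\in\omega$ and ordinal $\alpha$ a full set $\models^\alpha_n$ of formulas ($\downarrow AB$ in it iff neither $A$ nor $B$; $\forall vA$ in it iff all substitution instances $A^b_v$ are); $(\models^0_n)_n$ a fixed enumeration of full sets; for $\alpha>0$, $\mathcal TA\in\models^\alpha_n$ iff for some $\gamma<\alpha$, $A\in\models^\delta_n$ for all $\gamma\le\delta<\alpha$, and $a\in\{x\mid A\}\in\models^\alpha_n$ iff $\mathcal TA^a_x\in\models^\alpha_n$. $\models^\alpha B$ iff $B\in\models^\alpha_n$ for all $n$. $\mathrm{IN}^\alpha(A)$ iff $\models^\beta\mathcal TA$ for all $\beta\ge\alpha$; $\mathrm{IN}(A)$ iff $\exists\alpha\,\mathrm{IN}^\alpha(A)$; $\alpha$ stabilizes $A$ iff ($\mathrm{IN}(A)\Rightarrow\mathrm{IN}^\alpha(A)$) and ($\models^\alpha\mathcal TA\Rightarrow\mathrm{IN}(A)$); $\varpi$ is the least ordinal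 stabilizing every sentence. $\Vdash A$ ($A$ is a thesis of £) iff $\neg\mathcal T\neg A\in\models^\varpi_n$ for all $n$. A theory is progressive if its theses properly extend those of classical logic, moderate if none of its theses is the negation of a theorem of classical logic, and classic if it is progressive and moderate. *)

(* Defs.v *)
From Stdlib Require Import Arith Lia Wellfounded.
From Stdlib Require Import Classical FunctionalExtensionality PropExtensionality.

(* Variables are de Bruijn indices: [Abs A] is {v | A} and [All A] is ∀v A, with
   v the index 0 of A.  Names may be formed of formulas and of terms, and the
   free variables of an expression are free in its name, so that one can
   quantify into 𝒯A. *)
Inductive term : Set :=
| Var (i : nat)
| Tset
| Fset
| Abs (A : formula)
| NameF (A : formula)
| NameT (t : term)
with formula : Set :=
| In (a b : term)
| Nor (A B : formula)
| All (A : formula).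

Definition Neg (A : formula) : formula := Nor A A.
Definition Or (A B : formula) : formula := Neg (Nor A B).
Definition Imp (A B : formula) : formula := Or (Neg A) B.
Definition Tr (A : formula) : formula := In (NameF A) Tset.

Definition up_ren (r : nat -> nat) (i : nat) : nat :=
  match i with 0 => 0 | S j => S (r j) end.

Fixpoint ren_term (r : nat -> nat) (t : term) : term :=
  match t with
  | Var i => Var (r i)
  | Tset => Tset
  | Fset => Fset
  | Abs A => Abs (ren_form (up_ren r) A)
  | NameF A => NameF (ren_form r A)
  | NameT u => NameT (ren_term r u)
  end
with ren_form (r : nat -> nat) (A : formula) : formula :=
  match A with
  | In a b => In (ren_term r a) (ren_term r b)
  | Nor B C => Nor (ren_form r B) (ren_form r C)
  | All B => All (ren_form (up_ren r) B)
  end.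

Definition up (s : nat -> term) (i : nat) : term :=
  match i with 0 => Var 0 | S j => ren_term S (s j) end.

Fixpoint subst_term (s : nat -> term) (t : term) : term :=
  match t with
  | Var i => s i
  | Tset => Tset
  | Fset => Fset
  | Abs A => Abs (subst_form (up s) A)
  | NameF A => NameF (subst_form s A)
  | NameT u => NameT (subst_term s u)
  end
with subst_form (s : nat -> term) (A : formula) : formula :=
  match A with
  | In a b => In (subst_term s a) (subst_term s b)
  | Nor B C => Nor (subst_form s B) (subst_form s C)
  | All B => All (subst_form (up s) B)
  end.

(* [inst A b] is A^b_v, v being the index 0 of A. *)
Definition inst (A : formula) (b : term) : formula :=
  subst_form (fun i => match i with 0 => b | S j => Var j end) A.

(* All free variables are below [k]. *)
Fixpoint bounded_term (k : nat) (t : term) : Prop :=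
  match t with
  | Var i => i < k
  | Tset => True
  | Fset => True
  | Abs A => bounded_form (S k) A
  | NameF A => bounded_form k A
  | NameT u => bounded_term k u
  end
with bounded_form (k : nat) (A : formula) : Prop :=
  match A with
  | In a b => bounded_term k a /\ bounded_term k b
  | Nor B C => bounded_form k B /\ bounded_form k C
  | All B => bounded_form (S k) B
  end.

Definition sentence (A : formula) : Prop := bounded_form 0 A.

Definition tautology (A : formula) : Prop :=
  forall v : formula -> bool,
    (forall B C, v (Nor B C) = negb (orb (v B) (v C))) -> v A = true.

Inductive provable : formula -> Prop :=
| prov_taut A : tautology A -> provable A
| prov_inst A b : provable (Imp (All A) (inst A b))
| prov_dist A B : provable (Imp (All (Imp A B)) (Imp (All A) (All B)))
| prov_vac A : provable (Imp A (All (ren_form S A)))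
| prov_mp A B : provable (Imp A B) -> provable A -> provable B
| prov_gen A : provable A -> provable (All A).

(* [osup I f] is the least ordinal strictly above all the [f i].  Distinct
   trees may denote the same ordinal; equality of ordinals is [ole] both ways. *)
Inductive ord : Type := osup (I : Type) (f : I -> ord).

Fixpoint ole (a b : ord) : Prop :=
  match a, b with osup K f, osup J g => forall i, exists j, ole (f i) (g j) end.

Definition olt (a b : ord) : Prop :=
  match b with osup J g => exists j, ole a (g j) end.

Definition ozero : ord := osup Empty_set (fun e => match e with end).

Definition full (X : formula -> Prop) : Prop :=
  (forall A B, X (Nor A B) <-> ~ X A /\ ~ X B) /\
  (forall A, X (All A) <-> forall b, X (inst A b)).

Definition family : Type := ord -> nat -> formula -> Prop.

(* [M a n A] is A ∈ ⊨^a_n.  The initial enumeration is [M ozero]; the atomic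
   formulas for which no clause is laid down are left unconstrained. *)
Record libra_semantics (M : family) : Prop := {
  sem_ext : forall a b n A, ole a b -> ole b a -> M a n A -> M b n A;
  sem_full : forall a n, full (M a n);
  sem_truth : forall a n A, olt ozero a ->
    (M a n (Tr A) <->
     exists c, olt c a /\ forall d, ole c d -> olt d a -> M d n A);
  sem_abs : forall a n x A, olt ozero a ->
    (M a n (In x (Abs A)) <-> M a n (Tr (inst A x)))
}.

Definition holds (M : family) (a : ord) (A : formula) : Prop := forall n, M a n A.

Definition IN_from (M : family) (a : ord) (A : formula) : Prop :=
  forall b, ole a b -> holds M b (Tr A).

Definition IN (M : family) (A : formula) : Prop := exists a, IN_from M a A.

Definition stabilizes (M : family) (a : ord) (A : formula) : Prop :=
  (IN M A -> IN_from M a A) /\ (holds M a (Tr A) -> IN M A).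

Definition stabilizes_all (M : family) (a : ord) : Prop :=
  forall A, sentence A -> stabilizes M a A.

Definition is_varpi (M : family) (w : ord) : Prop :=
  stabilizes_all M w /\ forall a, stabilizes_all M a -> ole w a.

Definition thesis (M : family) (A : formula) : Prop :=
  exists w, is_varpi M w /\ holds M w (Neg (Tr (Neg A))).

Definition progressive (Th : formula -> Prop) : Prop :=
  (forall A, sentence A -> provable A -> Th A) /\
  (exists A, sentence A /\ Th A /\ ~ provable A).

Definition moderate (Th : formula -> Prop) : Prop :=
  forall A, sentence A -> ~ (Th A /\ provable (Neg A)).

Definition classic_theory (Th : formula -> Prop) : Prop :=
  progressive Th /\ moderate Th.

Lemma ole_refl a : ole a a.
Proof. induction a as [I f IH]; simpl; intro i; exists i; apply IH. Qed.

Lemma ole_trans a : forall b c, ole a b -> ole b c -> ole a c.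
Proof.
  induction a as [I f IH]; intros [J g] [K h] H1 H2 i; simpl in *.
  destruct (H1 i) as [j Hj]; destruct (H2 j) as [k Hk].
  exists k; exact (IH i _ _ Hj Hk).
Qed.

Lemma olt_ole_trans a b c : olt a b -> ole b c -> olt a c.
Proof.
  destruct b as [J g], c as [K h]; simpl; intros [j Hj] H.
  destruct (H j) as [k Hk]; exists k; exact (ole_trans _ _ _ Hj Hk).
Qed.

Lemma olt_wf : well_founded olt.
Proof.
  assert (H : forall a b, ole b a -> Acc olt b).
  { induction a as [I f IH]; intros [J g] Hb; constructor; intros c [j Hj].
    destruct (Hb j) as [i Hi]; apply (IH i); exact (ole_trans _ _ _ Hj Hi). }
  intro a; exact (H a a (ole_refl a)).
Qed.

Fixpoint depth (A : formula) : nat :=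
  match A with
  | In _ _ => 0
  | Nor B C => S (max (depth B) (depth C))
  | All B => S (depth B)
  end.

Lemma depth_subst A : forall s, depth (subst_form s A) = depth A.
Proof.
  revert A; fix IH 1; intros [a b|B C|B] s; simpl;
    [reflexivity | rewrite !IH; reflexivity | rewrite IH; reflexivity].
Qed.

Fixpoint eval (v : term -> term -> Prop) (k : nat) (A : formula) : Prop :=
  match k, A with
  | _, In a b => v a b
  | 0, _ => False
  | S k, Nor B C => ~ eval v k B /\ ~ eval v k C
  | S k, All B => forall b, eval v k (inst B b)
  end.

Lemma eval_stable v k : forall l A, depth A <= k -> depth A <= l ->
  (eval v k A <-> eval v l A).
Proof.
  induction k as [|k IH]; intros l [a b|B C|B] Hk Hl; simpl in *; try lia;
    destruct l as [|l]; simpl; try lia; try tauto.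
  - rewrite (IH l B), (IH l C) by lia; tauto.
  - split; intros H b; specialize (H b); revert H;
      apply (IH l (inst B b)); unfold inst; rewrite depth_subst; lia.
Qed.

Lemma eval_full v : full (fun A => eval v (depth A) A).
Proof.
  split; [intros A B | intros A]; simpl.
  - rewrite (eval_stable v _ (depth A) A), (eval_stable v _ (depth B) B) by lia.
    tauto.
  - split; intros H b; specialize (H b); unfold inst in *;
      rewrite depth_subst in *; exact H.
Qed.

Definition atoms_at (X : formula -> Prop) (a b : term) : Prop :=
  match b, a with
  | Tset, NameF A => X A
  | Abs A, _ => X (inst A a)
  | _, _ => False
  end.

Definition revise (M0 : nat -> formula -> Prop) (a : ord)
    (rec : forall d, olt d a -> nat -> formula -> Prop) (n : nat) (A : formula)
    : Prop :=
  (~ olt ozero a /\ M0 n A) \/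
  (olt ozero a /\
   eval (atoms_at (fun B => exists c, olt c a /\
           forall d (h : olt d a), ole c d -> rec d h n B)) (depth A) A).

Theorem libra_semantics_exists (M0 : nat -> formula -> Prop) :
  (forall n, full (M0 n)) ->
  exists M : family, libra_semantics M /\ forall n A, M ozero n A <-> M0 n A.
Proof.
  intro H0.
  set (M := Fix olt_wf (fun _ => nat -> formula -> Prop) (revise M0)).
  set (ev a n := fun B => exists c, olt c a /\
        forall d (h : olt d a), ole c d -> M d n B).
  assert (E : forall a n A, M a n A <->
    (~ olt ozero a /\ M0 n A) \/
    (olt ozero a /\ eval (atoms_at (ev a n)) (depth A) A)).
  { intros a n A; unfold M at 1; rewrite Fix_eq; [reflexivity|].
    intros x f g Hfg; replace g with f; [reflexivity|].
    apply functional_extensionality_dep; intro d.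
    apply functional_extensionality_dep; intro h; apply Hfg. }
  assert (P : forall a n A, olt ozero a ->
    (M a n A <-> eval (atoms_at (ev a n)) (depth A) A))
    by (intros; rewrite E; tauto).
  assert (Z : forall a n A, ~ olt ozero a -> (M a n A <-> M0 n A))
    by (intros; rewrite E; tauto).
  exists M; split; [split|].
  - intros a b n A Hab Hba.
    assert (L : forall d, olt d a <-> olt d b)
      by (intro d; split; intro; eapply olt_ole_trans; eassumption).
    assert (Ev : ev a n = ev b n).
    { apply functional_extensionality; intro B.
      apply propositional_extensionality; unfold ev.
      split; intros [c [Hc H]]; exists c; split; try (apply L; exact Hc);
        intros d Hd; apply H; apply L; exact Hd. }
    rewrite (E a), (E b), Ev, (L ozero); tauto.
  - intros a n; destruct (classic (olt ozero a)) as [Ha|Ha].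
    + replace (M a n) with (fun A => eval (atoms_at (ev a n)) (depth A) A);
        [apply eval_full|].
      apply functional_extensionality; intro A.
      apply propositional_extensionality; symmetry; apply P; exact Ha.
    + replace (M a n) with (M0 n); [apply H0|].
      apply functional_extensionality; intro A.
      apply propositional_extensionality; symmetry; apply Z; exact Ha.
  - intros a n A Ha; rewrite (P a n (Tr A) Ha); simpl; unfold ev.
    split; intros [c [Hc H]]; exists c; split; auto.
  - intros a n x A Ha; rewrite !P by exact Ha; reflexivity.
  - intros n A; apply Z; intros [[]].
Qed.

(* Main.v *)
Require Import Defs.
From Stdlib Require Import Classical IndefiniteDescription.

(** Call a formula settled when, from some stage on, it lies in every
    [⊨^a_n].  Settledness coincides with [IN], it is inherited from [A] by [𝒯A]
    and by [¬𝒯¬A], and a settled sentence holds at every stabilizing stage [w],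
    because [IN A] forces [𝒯A] to hold at [w + 1].  Full sets contain all
    classical theorems, so these are settled; this gives both moderateness and
    the inclusion of classical logic.  The thesis [𝒯⊤] is not a classical
    theorem, since it fails in a full set without atoms.

    That [ϖ] exists at all is a reflection argument: a suitable limit stage [a]
    is such that any of the set-many properties [A ∈ ⊨^d_n] of [d] which holds
    on a final segment of the stages below [a] holds on a final segment of all
    stages. *)

Scheme term_formula_ind := Induction for term Sort Prop
  with formula_term_ind := Induction for formula Sort Prop.
Combined Scheme expr_ind from term_formula_ind, formula_term_ind.

(** * Substitution *)

Definition scons (b : term) (s : nat -> term) (i : nat) : term :=
  match i with 0 => b | S j => s j end.

Lemma up_ren_comp r s u :
  (forall i, s (r i) = u i) -> forall i, up_ren s (up_ren r i) = up_ren u i.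
Proof. intros E [|i]; simpl; [reflexivity | now rewrite E]. Qed.

Lemma ren_ren :
  (forall t r s u, (forall i, s (r i) = u i) ->
     ren_term s (ren_term r t) = ren_term u t) /\
  (forall A r s u, (forall i, s (r i) = u i) ->
     ren_form s (ren_form r A) = ren_form u A).
Proof.
  apply expr_ind; simpl; auto; intros; f_equal; auto using up_ren_comp.
Qed.

Lemma up_comp_ren r s u :
  (forall i, s (r i) = u i) -> forall i, up s (up_ren r i) = up u i.
Proof. intros E [|i]; simpl; [reflexivity | now rewrite E]. Qed.

Lemma subst_ren :
  (forall t r s u, (forall i, s (r i) = u i) ->
     subst_term s (ren_term r t) = subst_term u t) /\
  (forall A r s u, (forall i, s (r i) = u i) ->
     subst_form s (ren_form r A) = subst_form u A).
Proof.
  apply expr_ind; simpl; auto; intros; f_equal; auto using up_comp_ren.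
Qed.

Lemma ren_up r s u :
  (forall i, ren_term r (s i) = u i) ->
  forall i, ren_term (up_ren r) (up s i) = up u i.
Proof.
  intros E [|i]; simpl; [reflexivity|]; rewrite <- E.
  rewrite (proj1 ren_ren _ r S (fun j => S (r j))) by reflexivity.
  now apply (proj1 ren_ren).
Qed.

Lemma ren_subst :
  (forall t s r u, (forall i, ren_term r (s i) = u i) ->
     ren_term r (subst_term s t) = subst_term u t) /\
  (forall A s r u, (forall i, ren_term r (s i) = u i) ->
     ren_form r (subst_form s A) = subst_form u A).
Proof.
  apply expr_ind; simpl; auto; intros; f_equal; auto using ren_up.
Qed.

Lemma subst_up r s u :
  (forall i, subst_term s (r i) = u i) ->
  forall i, subst_term (up s) (up r i) = up u i.
Proof.
  intros E [|i]; simpl; [reflexivity|]; rewrite <- E.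
  rewrite (proj1 ren_subst _ s S (fun j => ren_term S (s j))) by reflexivity.
  now apply (proj1 subst_ren).
Qed.

Lemma subst_subst :
  (forall t r s u, (forall i, subst_term s (r i) = u i) ->
     subst_term s (subst_term r t) = subst_term u t) /\
  (forall A r s u, (forall i, subst_term s (r i) = u i) ->
     subst_form s (subst_form r A) = subst_form u A).
Proof.
  apply expr_ind; simpl; auto; intros; f_equal; auto using subst_up.
Qed.

Lemma up_id s : (forall i, s i = Var i) -> forall i, up s i = Var i.
Proof. intros E [|i]; simpl; [reflexivity | now rewrite E]. Qed.

Lemma subst_id :
  (forall t s, (forall i, s i = Var i) -> subst_term s t = t) /\
  (forall A s, (forall i, s i = Var i) -> subst_form s A = A).
Proof.
  apply expr_ind; simpl; auto; intros; f_equal; auto using up_id.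
Qed.

Lemma inst_subst_up s A b :
  inst (subst_form (up s) A) b = subst_form (scons b s) A.
Proof.
  apply (proj2 subst_subst); intros [|i]; simpl; [reflexivity|].
  rewrite (proj1 subst_ren _ S _ Var) by reflexivity.
  now apply (proj1 subst_id).
Qed.

Lemma subst_inst s A b :
  subst_form s (inst A b) = subst_form (scons (subst_term s b) s) A.
Proof. apply (proj2 subst_subst); now intros [|i]. Qed.

Lemma subst_scons_ren s A b :
  subst_form (scons b s) (ren_form S A) = subst_form s A.
Proof. now apply (proj2 subst_ren). Qed.

Lemma tautology_subst s A : tautology A -> tautology (subst_form s A).
Proof.
  intros HA v Hv; apply (HA (fun B => v (subst_form s B))).
  intros B C; apply Hv.
Qed.

(** * Soundness of classical logic for full sets *)

Section FullSets.

Variable X : formula -> Prop.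
Hypothesis X_full : full X.

Lemma full_neg A : X (Neg A) <-> ~ X A.
Proof. unfold Neg; rewrite (proj1 X_full); tauto. Qed.

Lemma full_imp A B : X (Imp A B) <-> (X A -> X B).
Proof.
  unfold Imp, Or; rewrite full_neg, (proj1 X_full), full_neg; tauto.
Qed.

Lemma full_subst_imp s A B :
  X (subst_form s (Imp A B)) <-> (X (subst_form s A) -> X (subst_form s B)).
Proof. exact (full_imp (subst_form s A) (subst_form s B)). Qed.

Lemma full_subst_all s A :
  X (subst_form s (All A)) <-> forall b, X (subst_form (scons b s) A).
Proof.
  simpl; rewrite (proj2 X_full).
  split; intros H b; specialize (H b); rewrite inst_subst_up in *; exact H.
Qed.

Lemma full_tautology A : tautology A -> X A.
Proof.
  intros HA.
  assert (decide : forall B, exists v : bool, v = true <-> X B).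
  { intros B; destruct (classic (X B)); [exists true | exists false];
      intuition discriminate. }
  apply functional_choice in decide; destruct decide as [v v_spec].
  apply v_spec, HA; intros B C.
  pose proof (proj1 X_full B C) as nor; rewrite <- !v_spec in nor.
  destruct (v (Nor B C)), (v B), (v C); simpl; intuition congruence.
Qed.

(* Closing under substitution makes the induction pass generalization. *)
Lemma provable_full_subst A : provable A -> forall s, X (subst_form s A).
Proof.
  induction 1 as [A HA|A b|A B|A|A B _ IHimp _ IHA|A _ IH]; intros s.
  - apply full_tautology, tautology_subst, HA.
  - rewrite full_subst_imp, full_subst_all, subst_inst; auto.
  - rewrite !full_subst_imp, !full_subst_all; intros Himp HA b.
    apply (full_subst_imp _ A); auto.
  - rewrite full_subst_imp, full_subst_all; intros HA b.
    now rewrite subst_scons_ren.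
  - apply (full_subst_imp _ A); auto.
  - rewrite full_subst_all; auto.
Qed.

Lemma provable_full A : provable A -> X A.
Proof.
  intros HA; rewrite <- (proj2 subst_id A Var) by reflexivity.
  now apply provable_full_subst.
Qed.

End FullSets.

Lemma atom_unprovable a b : ~ provable (In a b).
Proof. exact (provable_full _ (eval_full (fun _ _ => False)) (In a b)). Qed.

Lemma imp_refl_provable A : provable (Imp A A).
Proof.
  apply prov_taut; intros v Hv; unfold Imp, Or, Neg; rewrite !Hv.
  now destruct (v A).
Qed.

(** * Ordinals *)

Definition osucc (a : ord) : ord := osup unit (fun _ => a).

Lemma olt_osup I (f : I -> ord) i : olt (f i) (osup I f).
Proof. exists i; apply ole_refl. Qed.

Lemma olt_osucc a : olt a (osucc a).
Proof. exact (olt_osup unit _ tt). Qed.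

Lemma osucc_ole a b : ole (osucc a) b <-> olt a b.
Proof.
  destruct b as [J g]; split; intros H; [exact (H tt) | intros _; exact H].
Qed.

Lemma ole_olt_trans a b c : ole a b -> olt b c -> olt a c.
Proof.
  destruct c as [K h]; intros Hab [k Hbk]; exists k.
  exact (ole_trans _ _ _ Hab Hbk).
Qed.

Lemma olt_ole b : forall a, olt a b -> ole a b.
Proof.
  induction b as [J g IH]; intros [I f] [j Hj] i; exists j.
  exact (IH j _ (olt_ole_trans _ _ _ (olt_osup _ f i) Hj)).
Qed.

Lemma ole_or_olt a : forall b, ole a b \/ olt b a.
Proof.
  induction a as [I f IH]; intros b.
  destruct (classic (exists i, ole b (f i))) as [Hb|Hb]; [auto | left].
  destruct b as [J g]; intros i; apply NNPP; intros Hi.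
  apply Hb; exists i; specialize (IH i); destruct (f i) as [K h]; intros j.
  destruct (IH (g j)) as [Hj|Hj]; [exfalso; eauto | exact Hj].
Qed.

Lemma olt_upper_bound a b c :
  olt a c -> olt b c -> exists d, olt d c /\ ole a d /\ ole b d.
Proof.
  intros Hac Hbc; destruct (ole_or_olt a b) as [Hab|Hba];
    [exists b | exists a]; auto using ole_refl, olt_ole.
Qed.

Lemma olt_pos a b : olt a b -> olt ozero b.
Proof. apply ole_olt_trans; destruct a; intros []. Qed.

Lemma ord_least (P : ord -> Prop) a :
  P a -> exists w, P w /\ forall b, P b -> ole w b.
Proof.
  induction a as [a IH] using (well_founded_ind olt_wf); intros Ha.
  destruct (classic (exists b, olt b a /\ P b)) as [[b [Hb HP]]|Hleast];
    [eauto|].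
  exists a; split; [assumption|]; intros b Hb.
  destruct (ole_or_olt a b) as [Hab|Hba]; [assumption | exfalso; eauto].
Qed.

Lemma ord_collection {J : Type} (R : J -> ord -> Prop) :
  exists b, forall j, (exists d, R j d) -> exists d, olt d b /\ R j d.
Proof.
  assert (witness : forall j, exists d, (exists e, R j e) -> R j d).
  { intros j; destruct (classic (exists e, R j e)) as [[e He]|H];
      [exists e; auto | exists ozero; tauto]. }
  apply functional_choice in witness; destruct witness as [f f_spec].
  exists (osup J f); intros j Hj; exists (f j); auto using olt_osup.
Qed.

Lemma closure_point (F : ord -> ord) a0 :
  exists a, olt a0 a /\
    forall c, olt c a -> exists c', ole c c' /\ olt (F c') a.
Proof.
  set (stage k := Nat.iter k F a0).
  exists (osup nat stage); split; [exact (olt_osup _ stage 0)|].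
  intros c [k Hk]; exists (stage k); split; [exact Hk|].
  exact (olt_osup _ stage (S k)).
Qed.

Definition always_from (a : ord) (P : ord -> Prop) : Prop :=
  forall d, ole a d -> P d.

Definition eventually (P : ord -> Prop) : Prop := exists a, always_from a P.

Definition eventually_below (a : ord) (P : ord -> Prop) : Prop :=
  exists c, olt c a /\ forall d, ole c d -> olt d a -> P d.

Lemma eventually_forall {J : Type} (P : J -> ord -> Prop) :
  (forall j, eventually (P j)) -> eventually (fun d => forall j, P j d).
Proof.
  intros H.
  destruct (ord_collection (fun j a => always_from a (P j))) as [b Hb].
  exists b; intros d Hd j; destruct (Hb j (H j)) as [a [Hab Ha]].
  exact (Ha d (ole_trans _ _ _ (olt_ole _ _ Hab) Hd)).
Qed.

Lemma always_from_below a b P :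
  always_from a P -> olt a b -> eventually_below b P.
Proof. intros H Hab; exists a; auto. Qed.

Lemma eventually_below_osucc a P : eventually_below (osucc a) P -> P a.
Proof. intros [c [[_ Hca] H]]; exact (H a Hca (olt_osucc a)). Qed.

Lemma eventually_below_meet a P Q :
  eventually_below a P -> eventually_below a Q ->
  exists d, olt d a /\ P d /\ Q d.
Proof.
  intros [c [Hc HP]] [e [He HQ]].
  destruct (olt_upper_bound c e a Hc He) as [d [Hda [Hcd Hed]]].
  exists d; auto.
Qed.

Lemma ord_reflection {J : Type} (P : J -> ord -> Prop) :
  exists a, olt ozero a /\
    (forall j, eventually (P j) -> exists c, olt c a /\ always_from c (P j)) /\
    (forall j, eventually_below a (P j) -> eventually (P j)).
Proof.
  destruct (ord_collection (fun j c => always_from c (P j))) as [a0 Ha0].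
  assert (next : forall c, exists b, forall j,
    (exists d, ole c d /\ ~ P j d) -> exists d, olt d b /\ ole c d /\ ~ P j d)
    by (intros c; exact (ord_collection (fun j d => ole c d /\ ~ P j d))).
  apply functional_choice in next; destruct next as [F F_spec].
  destruct (closure_point F a0) as [a [Ha0a HF]].
  exists a; split; [exact (olt_pos _ _ Ha0a) | split; intros j Hj].
  - destruct (Ha0 j Hj) as [c [Hc Hfrom]]; exists c; split; [|exact Hfrom].
    exact (olt_ole_trans _ _ _ Hc (olt_ole _ _ Ha0a)).
  - destruct Hj as [c [Hca Hbelow]], (HF c Hca) as [c' [Hcc' HFa]].
    exists c'; intros d Hd; apply NNPP; intros Hfail.
    destruct (F_spec c' j) as [e [HeF [Hc'e He]]]; [eauto|].
    apply He, Hbelow; [exact (ole_trans _ _ _ Hcc' Hc'e)|].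
    exact (olt_ole_trans _ _ _ HeF (olt_ole _ _ HFa)).
Qed.

(** * Settled formulas *)

Lemma sentence_neg A : sentence A -> sentence (Neg A).
Proof. split; assumption. Qed.

Lemma sentence_truth A : sentence A -> sentence (Tr A).
Proof. split; [assumption | exact I]. Qed.

Section LibraSemantics.

Variable M : family.
Hypothesis M_libra : libra_semantics M.

Definition settled (A : formula) : Prop := eventually (fun d => holds M d A).

Lemma truth_iff a n A : olt ozero a ->
  (M a n (Tr A) <-> eventually_below a (fun d => M d n A)).
Proof. apply (sem_truth M M_libra). Qed.

Lemma neg_iff a n A : M a n (Neg A) <-> ~ M a n A.
Proof. apply full_neg, (sem_full M M_libra). Qed.

Lemma truth_osucc a A : holds M (osucc a) (Tr A) -> holds M a A.
Proof.
  intros H n; apply (eventually_below_osucc a (fun d => M d n A)).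
  apply truth_iff; [exact (olt_pos _ _ (olt_osucc a)) | exact (H n)].
Qed.

Lemma always_from_truth a A :
  always_from a (fun d => holds M d A) ->
  always_from (osucc a) (fun d => holds M d (Tr A)).
Proof.
  intros H d Hd n; apply osucc_ole in Hd.
  apply truth_iff; [exact (olt_pos _ _ Hd)|].
  apply (always_from_below a); [intros e He; exact (H e He n) | exact Hd].
Qed.

Lemma provable_settled A : provable A -> settled A.
Proof.
  intros HA; exists ozero; intros d _ n.
  exact (provable_full _ (sem_full M M_libra d n) A HA).
Qed.

Lemma settled_truth A : settled A -> settled (Tr A).
Proof. intros [a Ha]; exists (osucc a); exact (always_from_truth _ _ Ha). Qed.

Lemma settled_possible A : settled A -> settled (Neg (Tr (Neg A))).
Proof.
  intros [a Ha]; exists (osucc a); intros d Hd n.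
  apply neg_iff; intros Hneg.
  assert (Hpos : olt ozero d) by (apply (olt_pos a), osucc_ole, Hd).
  pose proof (always_from_truth _ _ Ha d Hd n) as Htrue.
  apply truth_iff in Htrue, Hneg; try exact Hpos.
  destruct (eventually_below_meet _ _ _ Htrue Hneg) as [e [_ [He Hne]]].
  exact (proj1 (neg_iff e n A) Hne He).
Qed.

Lemma IN_iff_settled A : IN M A <-> settled A.
Proof.
  split; [intros [a Ha] | exact (settled_truth A)].
  exists a; intros d Hd; apply truth_osucc, Ha.
  exact (ole_trans _ _ _ Hd (olt_ole _ _ (olt_osucc d))).
Qed.

Lemma settled_at_stabilizer w A :
  stabilizes_all M w -> sentence A -> settled A -> holds M w A.
Proof.
  intros Hw sA HA; apply IN_iff_settled in HA.
  apply truth_osucc, (proj1 (Hw A sA) HA), olt_ole, olt_osucc.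
Qed.

Lemma stabilizer_exists : exists a, forall A, stabilizes M a A.
Proof.
  destruct (ord_reflection (fun (p : nat * formula) d => M d (fst p) (snd p)))
    as [a [Hpos [Hfrom Hbelow]]].
  exists a; intros A; split; rewrite IN_iff_settled.
  - intros [e He] b Hab n.
    destruct (Hfrom (n, A)) as [c [Hca Hc]];
      [exists e; intros d Hd; exact (He d Hd n)|].
    pose proof (olt_ole_trans _ _ _ Hca Hab) as Hcb.
    apply truth_iff; [exact (olt_pos _ _ Hcb)|].
    exact (always_from_below _ _ _ Hc Hcb).
  - intros Htrue; apply (eventually_forall (fun n d => M d n A)); intros n.
    apply (Hbelow (n, A)), truth_iff; [exact Hpos | exact (Htrue n)].
Qed.

Lemma varpi_exists : exists w, is_varpi M w.
Proof.
  destruct stabilizer_exists as [a Ha].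
  apply (ord_least (stabilizes_all M) a); intros A _; apply Ha.
Qed.

Lemma settled_thesis A : sentence A -> settled A -> thesis M A.
Proof.
  intros sA HA; destruct varpi_exists as [w Hw].
  exists w; split; [exact Hw|].
  apply settled_at_stabilizer; [apply Hw | | exact (settled_possible A HA)].
  auto using sentence_neg, sentence_truth.
Qed.

Lemma settled_neg_not_thesis A : sentence A -> settled (Neg A) -> ~ thesis M A.
Proof.
  intros sA HnA [w [[Hw _] Hpossible]].
  apply (neg_iff w 0 (Tr (Neg A))); [exact (Hpossible 0)|].
  apply settled_at_stabilizer; [exact Hw | | exact (settled_truth _ HnA)].
  auto using sentence_neg, sentence_truth.
Qed.

End LibraSemantics.

Theorem theorem12p3p23 (M : family) (hM : libra_semantics M) :
  classic_theory (thesis M).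
Proof.
  split; [split|].
  - intros A sA HA.
    exact (settled_thesis M hM A sA (provable_settled M hM A HA)).
  - set (verum := Imp (In Tset Tset) (In Tset Tset)).
    assert (sV : sentence (Tr verum)) by (repeat split).
    exists (Tr verum); split; [exact sV | split].
    + apply (settled_thesis M hM _ sV), (settled_truth M hM).
      apply (provable_settled M hM), imp_refl_provable.
    + apply atom_unprovable.
  - intros A sA [HA HnA].
    exact (settled_neg_not_thesis M hM A sA (provable_settled M hM _ HnA) HA).
Qed.
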